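(* Let $k \ge 1$ be an integer. Suppose $X$ is a random element of $\mathbb{R}^k$ with density $f$ (with respect to Lebesgue measure) of the form $f = f_U 1_U$, where $U \subset \mathbb{R}^k$ is an open set, the function $f_U : U \to (0,\infty)$ is continuous, and $1_U : \mathbb{R}^k \to \{0,1\}$ denotes the indicator function of $U$ (so $f = f_U$ on $U$ and $f = 0$ outside $U$). Let $X_n$, $n = 1,2,\dots$, be arbitrary random elements of $\mathbb{R}^k$. Then $X_n$ converges in distribution to $X$ as $n \to \infty$ if and only if the following condition holds: for every $\varepsilon > 0$ there exists a real number $R < \infty$ such that every closed coordinate box $B$ satisfying $$B \subset U \quad \text{and} \quad R \, \operatorname{diam}(B) < d(B, U^c)$$ also satisfies $$\liminf_{n \to \infty} \mathbb{P}(X_n \in B) \ \ge\ (1-\varepsilon)\, \operatorname{vol}(B)\, \inf_{x \in B} f(x).$$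
   Context: A closed coordinate box in $\mathbb{R}^k$ is a set of the form $\prod_{i=1}^k [a_i, b_i]$ with real endpoints $a_i \le b_i$; $\operatorname{vol}(B)$ denotes its $k$-dimensional volume (Lebesgue measure). $\|x-y\|$ is the Euclidean distance on $\mathbb{R}^k$; $\operatorname{diam}(B) := \sup_{x,y \in B} \|x-y\|$; $d(x,S) := \inf_{y \in S} \|x-y\|$ is the distance from a point $x$ to a set $S$; and $d(A,B) := \inf_{x \in A} d(x,B)$ is the distance between sets $A$ and $B$ (the infimum over the empty set is $+\infty$, so $d(B,U^c) = +\infty$ when $U = \mathbb{R}^k$). $U^c$ is the complement of $U$ in $\mathbb{R}^k$. Convergence in distribution means $\mathbb{E}\, g(X_n) \to \mathbb{E}\, g(X)$ for all bounded uniformly continuous $g : \mathbb{R}^k \to \mathbb{R}$ (equivalently, $\liminf_n \mathbb{P}(X_n \in G) \ge \mathbb{P}(X \in G)$ for all open $G \subset \mathbb{R}^k$). *)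

(* Defs.v *)
From HB Require Import structures.
From mathcomp Require Import all_boot all_order all_algebra.
From mathcomp Require Import all_classical all_reals all_analysis.
From mathcomp Require Import measurable_realfun.

Set Implicit Arguments.
Unset Strict Implicit.
Unset Printing Implicit Defensive.

Import Order.TTheory GRing.Theory Num.Theory.
Import numFieldNormedType.Exports.

Local Open Scope classical_set_scope.
Local Open Scope ring_scope.

Section borel_rV.
Variables (R : realType) (n : nat).

(* Borel sigma-algebra of R^n, which is represented by row vectors. *)
HB.instance Definition _ := @isMeasurable.Build
  (sigma_display (@open 'rV[R]_n)) 'rV[R]_n <<s @open 'rV[R]_n >>
  (@sigma_algebra0 _ setT _) (@sigma_algebraC _ _)
  (@sigma_algebra_bigcup _ setT _).

Lemma open_measurable_rV (A : set 'rV[R]_n) : open A -> measurable A.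
Proof. exact: sub_sigma_algebra. Qed.

Let rat_cube (c : 'rV[rat]_n * nat) : set 'rV[R]_n :=
  [set v | forall i, `|ratr (c.1 ord0 i) - v ord0 i| < c.2.+1%:R^-1].

Let open_bigcup_rat_cube (A : set 'rV[R]_n) : open A ->
  A = \bigcup_(c in [set c | rat_cube c `<=` A]) rat_cube c.
Proof.
move=> oA; apply/seteqP; split=> [x Ax|x [c cA]]; last exact: cA.
have /nbhs_ballP[e/= e0 eA] : nbhs x A by exact: open_nbhs_nbhs.
have e20 : 0 < e / 2 by rewrite divr_gt0.
have [m] := ltr_add_invr e20; rewrite add0r => me.
have /choice[q qP] (i : 'I_n) :
    exists q : rat, `|ratr q - x ord0 i| < m.+1%:R^-1.
  have : x ord0 i < x ord0 i + m.+1%:R^-1 by rewrite ltrDl invr_gt0.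
  move=> /rat_in_itvoo[q]; rewrite in_itv/= => /andP[xq qx]; exists q.
  by rewrite gtr0_norm ?subr_gt0// ltrBlDl.
exists (\row_i q i, m) => /=; last by move=> i; rewrite mxE.
move=> y qy; apply: eA; split=> // i j; rewrite (ord1 i) /ball/=.
have := qy j; rewrite /= mxE => qyj.
rewrite (le_lt_trans (ler_distD (ratr (q j)) _ _))// [ltRHS]splitr.
by rewrite ltrD// (lt_trans _ me)// distrC.
Qed.

Lemma measurable_coord_rV (i : 'I_n) :
  measurable_fun [set: 'rV[R]_n] (fun v : 'rV[R]_n => v ord0 i).
Proof.
apply: (measurability _ (RGenOpens.measurableE R)) => _ [_ [a [b ->] <-]].
rewrite setTI; apply: open_measurable_rV; apply: open_comp => //.
by move=> v _; exact: coord_continuous.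
Qed.

Lemma measurable_fun_rVP d (T : measurableType d) (f : T -> 'rV[R]_n) :
  measurable_fun [set: T] f <->
  forall i, measurable_fun [set: T] (fun x => f x ord0 i).
Proof.
split=> [mf i|mf].
  exact: (measurableT_comp (measurable_coord_rV i) mf).
apply: (@measurability _ _ _ _ _ _ (@open 'rV[R]_n)) => // _ [A oA <-].
rewrite setTI (open_bigcup_rat_cube oA) preimage_bigcup bigcup_mkcond.
apply: countable_bigcupT_measurable => // c; case: ifPn => // _.
have -> : f @^-1` rat_cube c = \bigcap_(i in [set: 'I_n])
    (fun x => f x ord0 i) @^-1` ball (ratr (c.1 ord0 i) : R) c.2.+1%:R^-1.
  by apply/seteqP; split=> x /=; [move=> H i _; exact: H|move=> H i; exact: H].
apply: fin_bigcap_measurable => // i _.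
rewrite -[X in measurable X]setTI; apply: mf => //.
by apply: open_measurable; exact: ball_open.
Qed.

End borel_rV.

Section lebesgue_rV.
Variable R : realType.

(* The row vector whose head is [p.1] and whose tail is [p.2]. *)
Definition rV_cons n (p : R * 'rV[R]_n) : 'rV[R]_n.+1 :=
  \row_i oapp (p.2 ord0) p.1 (unlift ord0 i).

Lemma rV_cons0 n (p : R * 'rV[R]_n) : rV_cons p ord0 ord0 = p.1.
Proof. by rewrite mxE unlift_none. Qed.

Lemma rV_consS n (p : R * 'rV[R]_n) i : rV_cons p ord0 (lift ord0 i) = p.2 ord0 i.
Proof. by rewrite mxE liftK. Qed.

Definition rV_uncons n (v : 'rV[R]_n.+1) : R * 'rV[R]_n :=
  (v ord0 ord0, \row_i v ord0 (lift ord0 i)).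

Lemma rV_consK n : cancel (@rV_cons n) (@rV_uncons n).
Proof.
move=> [x v]; congr pair; first exact: rV_cons0.
by apply/rowP => i; rewrite mxE rV_consS.
Qed.

Lemma rV_unconsK n : cancel (@rV_uncons n) (@rV_cons n).
Proof.
move=> v; apply/rowP => i; rewrite mxE.
by case: unliftP => [j|] -> //=; rewrite mxE.
Qed.

Lemma measurable_rV_cons n : measurable_fun [set: R * 'rV[R]_n] (@rV_cons n).
Proof.
apply/measurable_fun_rVP => i; case: (unliftP ord0 i) => [j|] ->.
- under eq_fun do rewrite rV_consS.
  exact: (measurableT_comp (measurable_coord_rV j) measurable_snd).
- under eq_fun do rewrite rV_cons0.
  exact: measurable_fst.
Qed.

Lemma measurable_rV_uncons n :
  measurable_fun [set: 'rV[R]_n.+1] (@rV_uncons n).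
Proof.
apply: measurable_fun_pair; first exact: measurable_coord_rV.
apply/measurable_fun_rVP => i; under eq_fun do rewrite mxE.
exact: measurable_coord_rV.
Qed.

Section step.
Variables (n : nat) (mu : {sigma_finite_measure set 'rV[R]_n -> \bar R}).

Definition lebesgue_rV_step : set 'rV[R]_n.+1 -> \bar R :=
  pushforward (@lebesgue_measure R \x mu)%E (@rV_cons n).

Let step0 : lebesgue_rV_step set0 = 0%E.
Proof. by rewrite /lebesgue_rV_step /pushforward preimage_set0 measure0. Qed.

Let step_ge0 A : (0 <= lebesgue_rV_step A)%E.
Proof. by rewrite /lebesgue_rV_step /pushforward measure_ge0. Qed.

Let step_sigma_additive : semi_sigma_additive lebesgue_rV_step.
Proof.
have mcons B : measurable B -> measurable (@rV_cons n @^-1` B).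
  by move=> mB; rewrite -[X in measurable X]setTI; exact: measurable_rV_cons.
move=> F mF tF mUF; rewrite /lebesgue_rV_step /pushforward preimage_bigcup.
apply: measure_semi_sigma_additive => [m||]; first exact: mcons.
- apply/trivIsetP => /= i j _ _ ij; rewrite -preimage_setI.
  by move/trivIsetP : tF => /(_ _ _ _ _ ij) ->//; rewrite preimage_set0.
- by rewrite -preimage_bigcup; exact: mcons.
Qed.

HB.instance Definition _ := isMeasure.Build _ _ _ lebesgue_rV_step
  step0 step_ge0 step_sigma_additive.

Let step_sigma_finite : sigma_finite [set: 'rV[R]_n.+1] lebesgue_rV_step.
Proof.
have /sigma_finiteP[F [TF ndF Foo]] := sigma_finiteT (@lebesgue_measure R).
have /sigma_finiteP[G [TG ndG Goo]] := sigma_finiteT mu.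
exists (fun m => @rV_uncons n @^-1` (F m `*` G m)).
  rewrite -preimage_bigcup -[LHS](preimage_setT (@rV_uncons n)).
  congr (_ @^-1` _); rewrite -setXTT TF TG predeqE => -[x y]; split.
    move=> [/= [m _ Fmx] [k _ Gky]]; exists (maxn m k) => //; split.
    - by move: x Fmx; exact/subsetPset/ndF/leq_maxl.
    - by move: y Gky; exact/subsetPset/ndG/leq_maxr.
  by move=> [m _ []/= ? ?]; split; exists m.
move=> m; have [mF Fmoo] := Foo m; have [mG Gmoo] := Goo m.
have mFG : measurable (F m `*` G m) by exact: measurableX.
split; first by rewrite -[X in measurable X]setTI; exact: measurable_rV_uncons.
rewrite /lebesgue_rV_step /pushforward -comp_preimage.
have -> : @rV_uncons n \o @rV_cons n = id.
  by apply/funext => x; exact: rV_consK.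
by rewrite preimage_id product_measure1E// lte_mul_pinfty// ge0_fin_numE.
Qed.

HB.instance Definition _ := Measure_isSigmaFinite.Build _ _ _ lebesgue_rV_step
  step_sigma_finite.

End step.

(* n-dimensional Lebesgue measure on Borel sets, as an iterated product. *)
Fixpoint lebesgue_rV n : {sigma_finite_measure set 'rV[R]_n -> \bar R} :=
  match n with
  | 0%N => @dirac _ 'rV[R]_0 (0 : 'rV[R]_0) R
  | m.+1 => lebesgue_rV_step (lebesgue_rV m)
  end.

Definition coord_box n (a b : 'rV[R]_n) : set 'rV[R]_n :=
  [set x | forall i, a ord0 i <= x ord0 i <= b ord0 i].

Lemma measurable_coord_box n (a b : 'rV[R]_n) : measurable (coord_box a b).
Proof.
have -> : coord_box a b = \bigcap_(i in [set: 'I_n])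
    (fun v : 'rV[R]_n => v ord0 i) @^-1` `[a ord0 i, b ord0 i].
  apply/seteqP; split=> x /= H i; first by move=> _; rewrite /= in_itv/=.
  by have := H i I; rewrite /= in_itv/=.
apply: fin_bigcap_measurable => // i _.
by rewrite -[X in measurable X]setTI; apply: measurable_coord_rV.
Qed.

(* Sanity check, characterising [lebesgue_rV n] among Borel measures. *)
Lemma lebesgue_rV_coord_box n (a b : 'rV[R]_n) :
  (forall i, a ord0 i <= b ord0 i) ->
  lebesgue_rV n (coord_box a b) = (\prod_i (b ord0 i - a ord0 i))%:E.
Proof.
elim: n a b => [|n IHn] a b ab.
  rewrite /= big_ord0 diracE mem_set//; by case.
rewrite big_ord_recl EFinM/= /lebesgue_rV_step /pushforward.
have -> : @rV_cons n @^-1` coord_box a b =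
    `[a ord0 ord0, b ord0 ord0] `*` coord_box (rV_uncons a).2 (rV_uncons b).2.
  apply/seteqP; split=> [[x v] /= H|[x v] /= [/= x0 xS] i].
    split=> /=; first by have := H ord0; rewrite in_itv/= rV_cons0.
    by move=> i /=; have := H (lift ord0 i); rewrite rV_consS !mxE.
  case: (unliftP ord0 i) => [j|] ->; last by rewrite rV_cons0.
  by have := xS j; rewrite rV_consS !mxE.
rewrite product_measure1E//; last exact: measurable_coord_box.
rewrite IHn => [|i]; last by rewrite !mxE.
congr (_ * _)%E; last by congr EFin; apply: eq_bigr => i _; rewrite !mxE.
have := lebesgue_measure_itv `[a ord0 ord0, b ord0 ord0] => /= ->.
rewrite lte_fin; case: ltP => [_|ba]; first by rewrite EFinB.
have -> : b ord0 ord0 = a ord0 ord0 by apply/le_anti; rewrite ba ab.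
by rewrite subrr.
Qed.

End lebesgue_rV.
Arguments lebesgue_rV {R} n.

Section euclidean_distance.
Variables (R : realType) (n : nat).
Implicit Types (x y : 'rV[R]_n) (A B : set 'rV[R]_n).

(* The library's norm on row vectors is the sup norm. *)
Definition eucl_dist x y : R := Num.sqrt (\sum_i (x ord0 i - y ord0 i) ^+ 2).

Definition diam A : \bar R :=
  ereal_sup [set (eucl_dist x y)%:E | x in A & y in A].

Definition dist_pt_set x A : \bar R :=
  ereal_inf [set (eucl_dist x y)%:E | y in A].

Definition dist_set A B : \bar R := ereal_inf [set dist_pt_set x B | x in A].

Definition closed_coord_box A :=
  exists a b : 'rV[R]_n, (forall i, a ord0 i <= b ord0 i) /\ A = coord_box a b.

End euclidean_distance.

Definition has_density d (T : measurableType d) (R : realType) (n : nat)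
    (P : probability T R) (X : {RV P >-> 'rV[R]_n}) (f : 'rV[R]_n -> R) : Prop :=
  [/\ measurable_fun [set: 'rV[R]_n] f, forall x, 0 <= f x &
      forall A, measurable A ->
        distribution P X A = (\int[lebesgue_rV n]_(x in A) (f x)%:E)%E].

(* The uniform structure on ['rV[R]_n] comes from the sup norm; it is the one
   of the Euclidean distance. *)
Definition cvg_in_distribution (R : realType) (n : nat)
    (dn : nat -> measure_display) (Tn : forall m, measurableType (dn m))
    (Pn : forall m, probability (Tn m) R)
    (Xn : forall m, {RV (Pn m) >-> 'rV[R]_n})
    (d : measure_display) (T : measurableType d) (P : probability T R)
    (X : {RV P >-> 'rV[R]_n}) : Prop :=
  forall g : 'rV[R]_n -> R,
    (exists M : R, forall x, `|g x| <= M) -> unif_continuous g ->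
    ('E_(Pn m)[g \o Xn m] @[m --> \oo] --> 'E_P[g \o X])%E.

(* Main.v *)
Require Import Defs.
From mathcomp Require Import all_boot all_order all_algebra.
From mathcomp Require Import all_classical all_reals all_analysis.
From mathcomp Require Import measurable_realfun ring lra.

(**
Write f for the density fU * \1_U, mu for the law of X and mu_n for that of Xn.

Convergence in distribution implies the box condition with r = 0. A
nondegenerate B contains a smaller concentric box B' with vol B' >= (1 - eps)
vol B, and a Lipschitz tent function lies between the indicators of B' and B
([box_bump_exists]). Integrating it against mu_n and mu and letting n tend to
infinity gives liminf mu_n(B) >= mu(B') >= vol(B') * inf_B f
([cvg_in_distribution_box]).

For the converse, it is enough to bound E g(Xn) from below, up to a factor close
to 1, by E g(X) when g >= 1 is bounded and continuous: for |g| <= M, the bounds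
for M + 1 + g and for M + 1 - g together give the limit
([cvg_of_multiplicative_bounds]).  All estimates are multiplicative, with one
parameter t < 1.  Cover [-m, m[ ^ k by a grid of closed cubes of side 1 / (m+1),
and inside each grid cube C take the cube B with the same corner and with side
s / (m+1), where s < 1 and s ^ k >= t.  The cubes B are pairwise disjoint, even
though they are closed; this matters because mu_n may charge the faces of the
grid.  Call C good when it is contained in U, when f and g vary on it by at most
the factor 1 / t, and when its B satisfies the hypothesis of the box condition.
Then:
- t ^ 3 * mu(C) <= vol(B) * inf_B f ([cube_mass_le]), so that the box condition
  with eps = 1 - t yields mu_n(B) >= t ^ 5 * mu(C) for all large n;
- as the cubes B are disjoint, E g(Xn) is at least t times the sum of
  g(corner of C) * mu_n(B) over the good C ([sum_cube_le_integral]);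
- around each point of U all small enough cubes are good, so Fatou's lemma under
  mu shows that, for some m, the sum of g(corner of C) * mu(C) over the good C
  is at least t ^ 2 * E g(X) ([integral_le_lower_sum]).
Together, E g(Xn) >= t ^ 8 * E g(X) for all large n ([near_integral_ge]).
*)

Set Implicit Arguments.
Unset Strict Implicit.
Unset Printing Implicit Defensive.

Import Order.TTheory GRing.Theory Num.Theory.
Import numFieldNormedType.Exports.

Local Open Scope classical_set_scope.
Local Open Scope ring_scope.

(** * Euclidean distance and grids of cubes *)

Section grid.
Variables (R : realType) (k : nat).
Implicit Types (x y : 'rV[R]_k) (m : nat) (t e : R).

Lemma coord_le_eucl_dist x y i : `|x ord0 i - y ord0 i| <= eucl_dist x y.
Proof.
rewrite /eucl_dist -sqrtr_sqr ler_sqrt ?sumr_ge0// => [|j _]; last exact: sqr_ge0.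
by rewrite (bigD1 i)//= lerDl sumr_ge0// => j _; exact: sqr_ge0.
Qed.

Lemma eucl_dist_le_coord x y e : 0 <= e ->
  (forall i, `|x ord0 i - y ord0 i| <= e) -> eucl_dist x y <= k%:R * e.
Proof.
move=> e0 xye; have ke0 : 0 <= k%:R * e by rewrite mulr_ge0.
rewrite /eucl_dist -(ger0_norm ke0) -sqrtr_sqr ler_sqrt ?sqr_ge0//.
rewrite (@le_trans _ _ (\sum_(i < k) e ^+ 2))//.
  by apply: ler_sum => i _; rewrite -real_normK ?num_real// ler_sqr ?nnegrE.
rewrite sumr_const card_ord -[e ^+ 2 *+ _]mulr_natl exprMn.
apply: ler_wpM2r; first exact: sqr_ge0.
by rewrite -natrX ler_nat; case: (k) => // n; rewrite -[leqLHS]expn1 leq_pexp2l.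
Qed.

(** Index of the cubes of side 1 / (m+1) whose corners run from -m to m by steps
of 1 / (m+1) in each coordinate.  The bound has the form n.+1 for [inord]. *)
Definition grid_index m : finType := {ffun 'I_k -> 'I_(m.+1 * m.*2).+1}.

Definition corner m (j : grid_index m) : 'rV[R]_k :=
  \row_i (- m%:R + (j i)%:R / m.+1%:R).

(** The parameter t rescales the side with the corner fixed: t = 1 gives the cubes
of the grid, and t < 1 the pairwise disjoint cubes inside them. *)
Definition cube t m (j : grid_index m) : set 'rV[R]_k :=
  coord_box (corner j) (\row_i (corner j ord0 i + t / m.+1%:R)).

Lemma cubeP t m (j : grid_index m) x : cube t j x <->
  forall i, - m%:R + (j i)%:R / m.+1%:R <= x ord0 i
            <= - m%:R + (j i)%:R / m.+1%:R + t / m.+1%:R.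
Proof. by split=> H i; move: (H i); rewrite !mxE. Qed.

Lemma measurable_cube t m (j : grid_index m) : measurable (cube t j).
Proof. exact: measurable_coord_box. Qed.

Lemma cube_closed_coord_box t m (j : grid_index m) : 0 <= t ->
  closed_coord_box (cube t j).
Proof.
move=> t0; exists (corner j); eexists; split; last by [].
by move=> i; rewrite !mxE lerDl divr_ge0.
Qed.

Lemma lebesgue_cube t m (j : grid_index m) : 0 <= t ->
  lebesgue_rV k (cube t j) = ((t / m.+1%:R) ^+ k)%:E.
Proof.
move=> t0; rewrite lebesgue_rV_coord_box => [|i]; last first.
  by rewrite !mxE lerDl divr_ge0.
under eq_bigr do rewrite !mxE [_ + t / _]addrC addrK.
by rewrite prodr_const card_ord.
Qed.

Lemma corner_cube t m (j : grid_index m) : 0 <= t -> cube t j (corner j).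
Proof. by move=> t0 i; rewrite !mxE lexx lerDl divr_ge0. Qed.

Lemma sub_cube t m (j : grid_index m) : t <= 1 -> cube t j `<=` cube 1 j.
Proof.
move=> t1 x /cubeP xj; apply/cubeP => i; have /andP[-> /= /le_trans->//] := xj i.
by rewrite lerD2l ler_pM2r ?invr_gt0.
Qed.

(** Two cubes with different indices are separated, in some coordinate, by a gap of at
least (1 - t) / (m+1). *)
Lemma cube_inj t m (j j' : grid_index m) x : t < 1 ->
  cube t j x -> cube t j' x -> j = j'.
Proof.
move=> t1 /cubeP xj /cubeP xj'; apply/ffunP => i; apply/val_inj/eqP => /=.
have m0 : 0 < m.+1%:R^-1 :> R by rewrite invr_gt0.
have le_index (a b : nat) (y : R) : - m%:R + b%:R / m.+1%:R <= y ->
    y <= - m%:R + a%:R / m.+1%:R + t / m.+1%:R -> (b <= a)%N.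
  move=> by_ ya; rewrite -ltnS -(ltr_nat R).
  have := le_trans by_ ya; rewrite -addrA lerD2l -mulrDl ler_pM2r// => h.
  by rewrite (le_lt_trans h)// -natr1 ltrD2l.
have /andP[a1 a2] := xj i; have /andP[b1 b2] := xj' i.
by rewrite eqn_leq (le_index _ _ _ a1 b2) (le_index _ _ _ b1 a2).
Qed.

Lemma grid_cover m x : (forall i, `|x ord0 i| < m%:R) ->
  exists j : grid_index m, cube 1 j x.
Proof.
move=> xm.
exists [ffun i => inord (Num.truncn ((x ord0 i + m%:R) * m.+1%:R))].
have m0 : 0 < m.+1%:R :> R by [].
apply/cubeP => i; rewrite ffunE.
have /andP[l u] : - m%:R < x ord0 i < m%:R by rewrite -ltr_norml.
have y0 : 0 <= (x ord0 i + m%:R) * m.+1%:R by rewrite mulr_ge0// -lerBlDr sub0r ltW.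
have /andP[h1 h2] := truncn_itv y0.
rewrite inordK; last first.
  rewrite ltnS; rewrite truncn_le_nat (@lt_le_trans _ _ ((m%:R + m%:R) * m.+1%:R))//.
    by rewrite ltr_pM2r// ltrD2r.
  by rewrite -natrD addnn -natrM ler_nat mulnC.
rewrite -lerBrDl opprK ler_pdivrMr// h1/= -addrA -mulrDl -lerBlDl opprK ler_pdivlMr//.
by rewrite natr1 ltW.
Qed.

Lemma cube_coord_close m (j : grid_index m) x y i :
  cube 1 j x -> cube 1 j y -> `|x ord0 i - y ord0 i| <= m.+1%:R^-1.
Proof.
move=> /cubeP/(_ i) + /cubeP/(_ i); rewrite mul1r.
move: (- m%:R + _) => c /andP[x1 x2] /andP[y1 y2].
rewrite ler_distlC; apply/andP; split.
  by rewrite lerBlDr (le_trans x2)// lerD2r.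
by rewrite (le_trans y2)// lerD2r.
Qed.

Lemma mesh_lt e : 0 < e -> \forall m \near \oo, m.+1%:R^-1 < e.
Proof. by move=> e0; exact: near_infty_natSinv_lt (PosNum e0). Qed.

Lemma near_cube_sub x (V : set 'rV[R]_k) : nbhs x V ->
  \forall m \near \oo, forall j : grid_index m, cube 1 j x -> cube 1 j `<=` V.
Proof.
move=> /nbhs_ballP[e/= e0 xeV].
have := mesh_lt e0; apply: filterS => m me j xj y yj; apply: xeV.
split=> // i l; rewrite (ord1 i) /ball/=.
exact: le_lt_trans (cube_coord_close l xj yj) me.
Qed.

Lemma near_grid_cover x :
  \forall m \near \oo, exists j : grid_index m, cube 1 j x.
Proof.
have [N _ xN] : \forall m \near \oo, forall i, `|x ord0 i| < m%:R.
  apply: (@filter_forall _ _ (fun i m => `|x ord0 i| < m%:R)) => i.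
  exact: nbhs_infty_gtr.
by exists N => // m /xN; exact: grid_cover.
Qed.

Lemma diam_cube t m (j : grid_index m) : t <= 1 ->
  (diam (cube t j) <= (k%:R * m.+1%:R^-1)%:E)%E.
Proof.
move=> t1; apply: ge_ereal_sup => _ [y yj [z zj <-]]; rewrite lee_fin.
apply: eucl_dist_le_coord => // i.
by apply: cube_coord_close; apply: sub_cube; eassumption.
Qed.

(** The diameter of the cube tends to 0 while its distance to the complement of U
stays at least half the radius of a ball around x inside U. *)
Lemma near_cube_isolated r t (U : set 'rV[R]_k) x : 0 <= t <= 1 ->
  open U -> U x ->
  \forall m \near \oo, forall j : grid_index m, cube 1 j x ->
    (r%:E * diam (cube t j) < dist_set (cube t j) (~` U))%E.
Proof.
move=> /andP[t0 t1] Uo Ux.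
have /nbhs_ballP[e/= e0 xeU] : nbhs x U by exact: open_nbhs_nbhs.
pose c : R := `|r| * k%:R + 1.
have c0 : 0 < c by rewrite ltr_wpDl// mulr_ge0.
have e2 : 0 < e / 2 by rewrite divr_gt0.
have ec : 0 < e / 2 / c by rewrite divr_gt0.
near=> m => j xj.
have me : m.+1%:R^-1 < e / 2 by near: m; exact: mesh_lt.
have mc : m.+1%:R^-1 < e / 2 / c by near: m; exact: mesh_lt.
apply: (@lt_le_trans _ _ (e / 2)%:E).
  apply: (@le_lt_trans _ _ (`|r| * (k%:R * m.+1%:R^-1))%:E).
    have d0 : (0 <= diam (cube t j))%E.
      apply: ereal_sup_ubound; exists (corner j); first exact: corner_cube.
      exists (corner j); first exact: corner_cube.
      by rewrite /eucl_dist big1 ?sqrtr0// => i _; rewrite subrr expr0n.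
    rewrite EFinM; apply: (@le_trans _ _ (`|r|%:E * diam (cube t j))%E).
      by rewrite lee_wpmul2r// lee_fin ler_norm.
    by rewrite lee_wpmul2l// ?lee_fin//; exact: diam_cube.
  rewrite lte_fin mulrA; move: mc; rewrite ltr_pdivlMr//; apply: le_lt_trans.
  by rewrite mulrC ler_pM2l ?invr_gt0// lerDl.
apply: le_ereal_inf_tmp => _ [y yj <-]; apply: le_ereal_inf_tmp => _ [z Uz <-].
rewrite lee_fin leNgt; apply/negP => yz; apply: Uz; apply: xeU.
split=> // i l; rewrite (ord1 i) /ball/=.
rewrite (le_lt_trans (ler_distD (y ord0 l) _ _))// [ltRHS]splitr ltrD//.
  exact: le_lt_trans (cube_coord_close l xj (sub_cube t1 yj)) me.
exact: le_lt_trans (coord_le_eucl_dist _ _ _) yz.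
Unshelve. all: by end_near. Qed.

End grid.

(** * Lower limits, functions of small oscillation, step functions *)

Section liminf.
Context {R : realType}.
Implicit Type u : (\bar R)^nat.

Lemma near_gt_limn_einf u w : (w < limn_einf u)%E ->
  \forall n \near \oo, (w < u n)%E.
Proof.
have := @nondecreasing_einfs _ u => /ereal_nondecreasing_cvgn/cvg_lim.
rewrite limn_einf_lim => ->//= /ereal_sup_gt[_ [N _ <-] wN].
exists N => // n /= Nn; apply: (lt_le_trans wN).
by apply: ereal_inf_lbound; exists n.
Qed.

Lemma le_limn_einf_near u w : (\forall n \near \oo, (w <= u n)%E) ->
  (w <= limn_einf u)%E.
Proof.
move=> [N _ wu]; have := @nondecreasing_einfs _ u => /ereal_nondecreasing_cvgn/cvg_lim.
rewrite limn_einf_lim => ->//=.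
apply: (@le_trans _ _ (einfs u N)); last by apply: ereal_sup_ubound; exists N.
by apply: le_ereal_inf_tmp => _ [n /= Nn <-]; exact: wu.
Qed.

Lemma le_limn_einf u v : (forall n, (u n <= v n)%E) ->
  (limn_einf u <= limn_einf v)%E.
Proof.
move=> uv; rewrite !limn_einf_lim; apply: lee_lim; try exact: is_cvg_einfs.
apply: nearW => n; apply: le_ereal_inf_tmp => _ [m /= nm <-].
by apply: le_trans (uv m); apply: ereal_inf_lbound; exists m.
Qed.

End liminf.

Section flat.
Context {R : realType} {T : topologicalType}.
Implicit Types (h : T -> R) (C : set T) (t : R).

(** For positive h, the oscillation of h on C is at most a factor 1 / t.  A
multiplicative bound is uniform even where a density is close to 0, and successive
errors simply multiply. *)
Definition flat_on t h C := forall y z, C y -> C z -> t * h y <= h z.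

Lemma near_flat_on t h x : 0 <= t < 1 -> 0 < h x -> {for x, continuous h} ->
  exists2 V, nbhs x V & flat_on t h V.
Proof.
move=> /andP[t0 t1] hx0 ch.
(* This radius makes t * (h x + e) <= h x - e. *)
pose e := h x * (1 - t) / 2.
have e0 : 0 < e by rewrite divr_gt0// mulr_gt0// subr_gt0.
have /cvgrPdist_lt/(_ _ e0) hxe := ch.
exists (fun y => `|h x - h y| < e); first exact: hxe.
move=> y z; rewrite !ltr_distlC => /andP[_ hy] /andP[hz _].
rewrite (@le_trans _ _ (t * (h x + e)))//; first by rewrite ler_wpM2l// ltW.
apply: le_trans (ltW hz); rewrite -subr_ge0.
have -> : h x - e - t * (h x + e) = h x * (1 - t) ^+ 2 / 2 by rewrite /e; field.
by rewrite divr_ge0// mulr_ge0 ?sqr_ge0// ltW.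
Qed.

Lemma sub_flat_on t h C C' : C `<=` C' -> flat_on t h C' -> flat_on t h C.
Proof. by move=> CC' hC' y z Cy Cz; apply: hC'; exact: CC'. Qed.

End flat.

Section integral_sum_indic.
Context d (T : measurableType d) (R : realType).
Variable mu : {measure set T -> \bar R}.

Lemma measurable_sum_indic (I : finType) (Q : pred I) (a : I -> R) (B : I -> set T)
    (D : set T) : (forall i, measurable (B i)) ->
  measurable_fun D (fun x => \sum_(i | Q i) a i * \1_(B i) x).
Proof.
move=> mB; under eq_fun do rewrite -big_filter.
by apply: measurable_sum => i; exact: measurable_funM.
Qed.

Lemma integral_sum_indic (I : finType) (Q : pred I) (a : I -> R) (B : I -> set T) :
  (forall i, 0 <= a i) -> (forall i, measurable (B i)) ->
  (\int[mu]_x (\sum_(i | Q i) a i * \1_(B i) x)%:E =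
   \sum_(i | Q i) (a i)%:E * mu (B i))%E.
Proof.
move=> a0 mB; under eq_integral do rewrite -sumEFin.
rewrite -big_filter; under eq_integral do rewrite -big_filter.
rewrite ge0_integral_sum//; last 2 first.
- move=> i; apply/measurable_EFinP; exact: measurable_funM.
- by move=> i x _; rewrite lee_fin mulr_ge0.
apply: eq_bigr => i _; under eq_integral do rewrite EFinM.
rewrite ge0_integralZl_EFin ?integral_indic ?setIT//; last exact/measurable_EFinP.
Qed.

End integral_sum_indic.

(** * Lower sums over good cubes *)

Section lower_sums.
Variables (R : realType) (k : nat).
Implicit Types (mu : probability 'rV[R]_k R) (U : set 'rV[R]_k).

Lemma continuous_measurable_rV (g : 'rV[R]_k -> R) : continuous g ->
  measurable_fun [set: 'rV[R]_k] g.
Proof.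
move=> cg; apply: (measurability _ (RGenOpens.measurableE R)).
move=> _ [_ [a [b ->] <-]]; rewrite setTI; apply: open_measurable_rV.
by apply: open_comp => // v _; exact: cg.
Qed.

Definition lower_sum mu (g : 'rV[R]_k -> R) m (good : pred (grid_index k m)) :=
  (\sum_(j | good j) (g (corner R j))%:E * mu (cube 1 j))%E.

(** Fatou's lemma applied to the step functions with value g(corner) on each good
cube.  Points on a common face are counted several times, which can only increase
these functions and so preserves the lower bound. *)
Lemma integral_le_lower_sum mu U (g : 'rV[R]_k -> R) t
    (good : forall m, pred (grid_index k m)) :
  open U -> mu (~` U) = 0%E -> continuous g -> (forall x, 0 <= g x) -> 0 <= t ->
  (forall m j, good m j -> flat_on t g (cube 1 j)) ->
  (forall x, U x -> \forall m \near \oo, forall j, cube 1 j x -> good m j) ->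
  (t%:E * \int[mu]_x (g x)%:E <= limn_einf (fun m => lower_sum mu g (good m)))%E.
Proof.
move=> Uo muU cg g0 t0 gflat Ugood.
have mU : measurable U by exact: open_measurable_rV.
have mg : measurable_fun [set: 'rV[R]_k] (EFin \o g).
  by apply/measurable_EFinP; exact: continuous_measurable_rV.
pose phi (m : nat) (x : 'rV[R]_k) : R :=
  \sum_(j | good m j) g (corner R j) * \1_(cube (1 : R) j) x.
have phi0 m x : 0 <= phi m x by apply: sumr_ge0 => j _; rewrite mulr_ge0.
have mphi m D : measurable D -> measurable_fun D (EFin \o phi m).
  move=> mD; apply/measurable_EFinP; apply: measurable_sum_indic => j.
  exact: measurable_cube.
have le_phi x : U x -> ((t * g x)%:E <= limn_einf (fun m => (phi m x)%:E))%E.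
  move=> Ux; apply: le_limn_einf_near.
  have := Ugood _ Ux; have := near_grid_cover x.
  apply: filterS2 => m [j xj] /(_ _ xj) gj; rewrite lee_fin.
  rewrite /phi (bigD1 j)//= indicE mem_set// mulr1.
  rewrite (le_trans (gflat _ _ gj _ (corner R j) xj _))//; first exact: corner_cube.
  by rewrite lerDl sumr_ge0// => i _; rewrite mulr_ge0.
rewrite -ge0_integralZl_EFin//; last by move=> x _; rewrite lee_fin.
rewrite (@ge0_negligible_integral _ _ _ mu _ (~` U))//; last 3 first.
- exact: measurableC.
- exact: measurable_funeM.
- by move=> x _; rewrite -EFinM lee_fin mulr_ge0.
rewrite setDE setCK setTI.
apply: (@le_trans _ _ (\int[mu]_(x in U) limn_einf (fun m => (phi m x)%:E))%E).
  apply: ge0_le_integral => //.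
  - by move=> x _; rewrite -EFinM lee_fin mulr_ge0.
  - by apply: measurable_funeM; exact: measurable_funTS.
  - rewrite /limn_einf; apply: measurableT_comp => //.
    apply: measurable_fun_limn_esup => m.
    by apply: measurableT_comp => //; exact: mphi.
apply: (@le_trans _ _ (limn_einf (fun m => \int[mu]_(x in U) (phi m x)%:E)%E)).
  apply: fatou => //.
  - by move=> m; exact: mphi.
  - by move=> m x _; rewrite lee_fin.
apply: le_limn_einf => m; rewrite /lower_sum -integral_sum_indic//; last first.
  by move=> j; exact: measurable_cube.
apply: ge0_subset_integral => //; first exact: mphi.
by move=> x _; rewrite lee_fin.
Qed.

(** One factor t comes from each of the following: the oscillation of f between the
corner and the points of the large cube, its oscillation over the small cube, and
the ratio s ^ k of the volumes. *)
Lemma cube_mass_le mu (f : 'rV[R]_k -> R) t s m (j : grid_index k m) :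
  measurable_fun [set: 'rV[R]_k] f -> (forall x, 0 <= f x) ->
  (forall A, measurable A -> mu A = (\int[lebesgue_rV k]_(x in A) (f x)%:E)%E) ->
  0 < t -> 0 <= s <= 1 -> t <= s ^+ k -> flat_on t f (cube 1 j) ->
  ((t ^+ 3)%:E * mu (cube 1 j) <=
   lebesgue_rV k (cube s j) * ereal_inf [set (f x)%:E | x in cube s j])%E.
Proof.
move=> mf f0 fmu t0 /andP[s0 s1] tsk fflat.
have cj : cube 1 j (corner R j) by exact: corner_cube.
pose v : R := m.+1%:R^-1 ^+ k.
have v0 : 0 <= v by rewrite exprn_ge0.
have le1 : (mu (cube 1 j) <= (t^-1 * f (corner R j) * v)%:E)%E.
  rewrite fmu; last exact: measurable_cube.
  apply: (@le_trans _ _ (\int[lebesgue_rV k]_(x in cube 1 j)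
      (t^-1 * f (corner R j))%:E)%E); last first.
    rewrite integral_cst; last exact: measurable_cube.
    by rewrite [X in (_ * X)%E](lebesgue_cube j ler01) mul1r -EFinM.
  apply: ge0_le_integral => //; first exact: measurable_cube.
  - by move=> x _; rewrite lee_fin.
  - by apply: measurable_funTS; apply/measurable_EFinP.
  - by move=> x xj; rewrite lee_fin mulrC ler_pdivlMr// mulrC; exact: fflat.
have le2 : ((t * f (corner R j))%:E <= ereal_inf [set (f x)%:E | x in cube s j])%E.
  apply: le_ereal_inf_tmp => _ [x xj <-]; rewrite lee_fin; apply: fflat => //.
  exact: sub_cube xj.
apply: (@le_trans _ _ ((t ^+ 3)%:E * (t^-1 * f (corner R j) * v)%:E)%E).
  by rewrite lee_wpmul2l// lee_fin exprn_ge0// ltW.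
apply: (@le_trans _ _ ((t * v)%:E * (t * f (corner R j))%:E)%E).
  rewrite -!EFinM lee_fin.
  have -> : t ^+ 3 * (t^-1 * f (corner R j) * v) = t * v * (t * f (corner R j)).
    by field; rewrite gt_eqF.
  by [].
rewrite lebesgue_cube// expr_div_n -exprVn -/v.
have t0' := ltW t0.
by apply: lee_pmul => //; rewrite lee_fin ?mulr_ge0 ?ler_wpM2r.
Qed.

(** At each point at most one term of the step function is nonzero, because s < 1
makes the small cubes disjoint; there it is bounded using the flatness of g. *)
Lemma sum_cube_le_integral (nu : probability 'rV[R]_k R) (g : 'rV[R]_k -> R) t s m
    (good : pred (grid_index k m)) :
  continuous g -> (forall x, 0 <= g x) -> 0 <= t -> s < 1 ->
  (forall j, good j -> flat_on t g (cube 1 j)) ->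
  (t%:E * \sum_(j | good j) (g (corner R j))%:E * nu (cube s j) <=
   \int[nu]_x (g x)%:E)%E.
Proof.
move=> cg g0 t0 s1 gflat.
have mg := continuous_measurable_rV cg.
rewrite -integral_sum_indic//; last by move=> j; exact: measurable_cube.
rewrite -ge0_integralZl_EFin//; last 2 first.
- by move=> x _; rewrite lee_fin sumr_ge0// => j _; rewrite mulr_ge0.
- apply/measurable_EFinP; apply: measurable_sum_indic => j.
  exact: measurable_cube.
apply: ge0_le_integral => //.
- move=> x _; rewrite -EFinM lee_fin mulr_ge0// sumr_ge0// => j _.
  by rewrite mulr_ge0.
- apply: measurable_funeM; apply/measurable_EFinP; apply: measurable_sum_indic => j.
  exact: measurable_cube.
- exact/measurable_EFinP.
move=> x _; rewrite -EFinM lee_fin.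
have [[j [gj xj]]|nx] := pselect (exists j, good j /\ cube s j x).
  rewrite (bigD1 j)//= big1 ?addr0 => [|i /andP[_ ij]]; last first.
    rewrite indicE memNset ?mulr0// => xi.
    by move: ij; rewrite (cube_inj s1 xi xj) eqxx.
  rewrite indicE mem_set// mulr1; apply: (gflat _ gj); last exact: sub_cube (ltW s1) _ xj.
  exact: corner_cube.
rewrite big1 ?mulr0// => j gj; rewrite indicE memNset ?mulr0// => xj.
by apply: nx; exists j.
Qed.

End lower_sums.

(** * From the box condition to lower bounds on integrals *)

Section convergence.
Variables (R : realType) (k : nat).

Lemma bernoulli_ge (u : R) n : 0 <= u <= 1 -> 1 - n%:R * u <= (1 - u) ^+ n.
Proof.
move=> /andP[u0 u1]; elim: n => [|n IHn]; first by rewrite mul0r subr0 expr0.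
rewrite exprS (@le_trans _ _ ((1 - u) * (1 - n%:R * u)))//; last first.
  by rewrite ler_wpM2l// subr_ge0.
have -> : (1 - u) * (1 - n%:R * u) = 1 - n.+1%:R * u + n%:R * (u * u).
  by rewrite -natr1; ring.
by rewrite lerDl !mulr_ge0.
Qed.

Lemma exists_lt1_expr_ge t n : 0 <= t < 1 -> exists2 s : R, 0 <= s < 1 & t <= s ^+ n.
Proof.
move=> /andP[t0 t1]; pose u : R := (1 - t) / n.+1%:R.
have u0 : 0 < u by rewrite divr_gt0// subr_gt0.
have u1 : u <= 1 by rewrite ler_pdivrMr// mul1r -natr1; have := ler0n R n; lra.
exists (1 - u); first by rewrite subr_ge0 u1 gtrDl oppr_lt0.
apply: le_trans (bernoulli_ge n _); last by rewrite u1 ltW.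
have : n.+1%:R * u = 1 - t by rewrite /u mulrC divfK.
by rewrite -natr1 mulrDl; lra.
Qed.

(** With t close to 1 the factor t ^ N costs at most 2 M (1 - t ^ N), so the lower
bounds for M + en and M - en are a lower and an upper bound for en. *)
Lemma cvg_of_multiplicative_bounds N (M e : R) (en : R^nat) :
  0 < M -> `|e| <= M ->
  (forall t, 0 < t < 1 -> \forall n \near \oo, t ^+ N * (M + e) <= M + en n) ->
  (forall t, 0 < t < 1 -> \forall n \near \oo, t ^+ N * (M - e) <= M - en n) ->
  en @ \oo --> e.
Proof.
move=> M0 eM lower upper; apply/cvgrPdist_lt => eps eps0.
have N0 : 0 <= N%:R :> R by [].
have NM0 : 0 <= N%:R * M by rewrite mulr_ge0// ltW.
pose u := eps / (2 * (N%:R * M) + eps).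
have den0 : 0 < 2 * (N%:R * M) + eps by rewrite ltr_wpDl// mulr_ge0.
have u0 : 0 < u by rewrite divr_gt0.
have uE : u * (2 * (N%:R * M) + eps) = eps by rewrite divfK// gt_eqF.
have u1 : u <= 1 by rewrite ler_pdivrMr// mul1r lerDr mulr_ge0.
have ue : 0 < u * eps by rewrite mulr_gt0.
pose t := 1 - u / 2.
have t01 : 0 < t < 1 by apply/andP; split; rewrite /t; lra.
have tN : 1 - N%:R * (u / 2) <= t ^+ N by apply: bernoulli_ge; lra.
have tN1 : t ^+ N <= 1 by case/andP: t01 => ? ?; rewrite exprn_ile1// ltW.
have /andP[eM1 eM2] : - M <= e <= M by rewrite -ler_norml.
(* The left-hand side is at most N u / 2 * 2 M = u N M, and u is chosen so that
   2 u N M + u eps = eps. *)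
have gap y : y <= M -> 0 <= M + y -> (1 - t ^+ N) * (M + y) < eps.
  move=> yM y0; apply: (@le_lt_trans _ _ (N%:R * (u / 2) * (2 * M))).
    by apply: ler_pM => //; lra.
  have -> : N%:R * (u / 2) * (2 * M) = u * (N%:R * M) by field.
  have : 0 <= u * (N%:R * M) by rewrite mulr_ge0// ltW.
  by rewrite -[ltRHS]uE mulrDr mulrCA; lra.
have gapP : (1 - t ^+ N) * (M + e) < eps by apply: gap => //; lra.
have gapN : (1 - t ^+ N) * (M - e) < eps by apply: gap; lra.
apply: filterS2 (lower t t01) (upper t t01) => n lo up.
by rewrite ltr_norml; apply/andP; split; lra.
Qed.

Variables (mu : probability 'rV[R]_k R) (mun : nat -> probability 'rV[R]_k R).
Variables (U : set 'rV[R]_k) (f : 'rV[R]_k -> R).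
Hypotheses (U_open : open U) (muU : mu (~` U) = 0%E).
Hypotheses (f_meas : measurable_fun [set: 'rV[R]_k] f) (f_ge0 : forall x, 0 <= f x).
Hypotheses (f_cont : forall x, U x -> {for x, continuous f})
  (f_gt0 : forall x, U x -> 0 < f x).
Hypothesis f_mu : forall A, measurable A ->
  mu A = (\int[lebesgue_rV k]_(x in A) (f x)%:E)%E.

(** The lower bound g >= 1 makes g flat near every point and the integral positive,
so that the strict inequality needed to select one level m of the grid holds.  The
exponent is 8 = 6 + 2: 5 from [mass], 1 from the flatness of g on the small cubes,
and 2 from Fatou's lemma, one of them spent on strictness. *)
Lemma near_integral_ge (g : 'rV[R]_k -> R) t r :
  continuous g -> (forall x, 1 <= g x) ->
  (\int[mu]_x (g x)%:E < +oo)%E -> 0 < t < 1 ->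
  (forall B, closed_coord_box B -> B `<=` U ->
    (r%:E * diam B < dist_set B (~` U))%E ->
    (t%:E * lebesgue_rV k B * ereal_inf [set (f x)%:E | x in B]
      <= limn_einf (fun n => mun n B))%E) ->
  \forall n \near \oo,
    ((t ^+ 8)%:E * \int[mu]_x (g x)%:E <= \int[mun n]_x (g x)%:E)%E.
Proof.
move=> cg g1 goo /andP[t0 t1] box_liminf.
have t01 : 0 <= t < 1 by rewrite t1 ltW.
have g0 x : 0 <= g x by exact: le_trans (g1 x).
have mg := continuous_measurable_rV cg.
have [s /andP[s0 s1] ts] := exists_lt1_expr_ge k t01.
have s01 : 0 <= s <= 1 by rewrite s0 ltW.
pose good m : pred (grid_index k m) := fun j =>
  `[< [/\ cube (1 : R) j `<=` U, flat_on t f (cube 1 j), flat_on t g (cube 1 j) &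
       (r%:E * diam (cube s j) < dist_set (cube s j) (~` U))%E] >].
have near_good x : U x -> \forall m \near \oo, forall j, cube 1 j x -> good m j.
  move=> Ux.
  have [V xV fV] := near_flat_on t01 (f_gt0 Ux) (f_cont Ux).
  have [W xW gW] := near_flat_on t01 (lt_le_trans ltr01 (g1 x)) (cg x).
  have xU : nbhs x U by exact: open_nbhs_nbhs.
  near=> m => j xj; apply/asboolP; split.
  - by move: j xj; near: m; exact: near_cube_sub.
  - apply: sub_flat_on fV; move: j xj; near: m; exact: near_cube_sub.
  - apply: sub_flat_on gW; move: j xj; near: m; exact: near_cube_sub.
  - by move: j xj; near: m; exact: near_cube_isolated.
have g_flat m j : good m j -> flat_on t g (cube 1 j) by move=> /asboolP[].
have mass m (j : grid_index k m) : good m j ->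
    \forall n \near \oo, ((t ^+ 5)%:E * mu (cube 1 j) <= mun n (cube s j))%E.
  move=> /asboolP[jU fj _ jsep].
  have mass_liminf : ((t ^+ 4)%:E * mu (cube 1 j) <=
      limn_einf (fun n => mun n (cube s j)))%E.
    apply: (le_trans _ (box_liminf _ _ _ jsep)); last 2 first.
    - exact: cube_closed_coord_box.
    - exact: subset_trans (sub_cube (ltW s1)) jU.
    rewrite exprS EFinM -!muleA lee_wpmul2l ?lee_fin ?(ltW t0)//.
    exact: (cube_mass_le f_meas f_ge0 f_mu).
  (* The fifth factor t turns the bound on the lower limit into a strict one. *)
  have mfin : mu (cube 1 j) \is a fin_num.
    by apply: fin_num_measure; exact: measurable_cube.
  have := measure_ge0 mu (cube 1 j); rewrite le_eqVlt => /predU1P[<-|mpos].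
    by apply: nearW => n; rewrite mule0.
  have strict : ((t ^+ 5)%:E * mu (cube 1 j) < (t ^+ 4)%:E * mu (cube 1 j))%E.
    by rewrite lte_pmul2r// lte_fin exprSr gtr_pMr// exprn_gt0.
  by apply: filterS (near_gt_limn_einf (lt_le_trans strict mass_liminf)) => n /ltW.
have lower m : \forall n \near \oo,
    ((t ^+ 6)%:E * lower_sum mu g (good m) <= \int[mun n]_x (g x)%:E)%E.
  have : \forall n \near \oo, forall j, good m j ->
      ((t ^+ 5)%:E * mu (cube 1 j) <= mun n (cube s j))%E.
    apply: filter_forall => j.
    have [gj|_] := boolP (good m j); last exact: nearW.
    by apply: filterS (mass m j gj).
  apply: filterS => n massn.
  apply: le_trans (sum_cube_le_integral _ cg g0 (ltW t0) s1 (@g_flat m)).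
  rewrite exprS EFinM -muleA lee_wpmul2l ?lee_fin ?(ltW t0)//.
  rewrite /lower_sum ge0_sume_distrr; last first.
    by move=> j _; rewrite mule_ge0// lee_fin.
  apply: lee_sum => j gj; rewrite muleCA lee_wpmul2l ?lee_fin//.
  exact: massn.
have gfin : (\int[mu]_x (g x)%:E)%E \is a fin_num.
  rewrite ge0_fin_numE//; apply: integral_ge0 => x _; by rewrite lee_fin.
have gpos : (0 < \int[mu]_x (g x)%:E)%E.
  apply: (@lt_le_trans _ _ (\int[mu]_x (cst 1%:E) x)%E).
    by rewrite integral_cst// mul1e [ltRHS]probability_setT lte_fin.
  by apply: ge0_le_integral => // [|x _]; [exact/measurable_EFinP|rewrite lee_fin].
have /near_gt_limn_einf[m _ /(_ m (leqnn m)) gm] :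
    ((t ^+ 2)%:E * \int[mu]_x (g x)%:E <
     limn_einf (fun m => lower_sum mu g (good m)))%E.
  apply: lt_le_trans (integral_le_lower_sum U_open muU cg g0 (ltW t0) g_flat near_good).
  by rewrite lte_pmul2r// lte_fin expr2 gtr_pMr.
apply: filterS (lower m) => n; apply: le_trans.
rewrite (_ : 8 = 6 + 2)%N// exprD EFinM -muleA lee_wpmul2l ?lee_fin ?exprn_ge0 ?(ltW t0)//.
exact: ltW gm.
Unshelve. all: by end_near. Qed.

End convergence.

(** * Expectations of bounded continuous functions *)

Section expectation.
Variables (R : realType) (k : nat).

Lemma unif_continuous_continuous (g : 'rV[R]_k -> R) :
  unif_continuous g -> continuous g.
Proof.
move=> /unif_continuousP ug x; apply/(cvg_ballP (F := nbhs x)) => e e0.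
have [d d0 gd] := ug e e0.
by apply/nbhs_ballP; exists d => // y xy; exact: (gd (x, y)).
Qed.

Lemma bounded_Lfun1 d (T : measurableType d) (P : probability T R)
    (X : {RV P >-> 'rV[R]_k}) (g : 'rV[R]_k -> R) (M : R) :
  continuous g -> (forall x, `|g x| <= M) -> (g \o X : T -> R) \in Lfun P 1.
Proof.
move=> cg gM; apply/Lfun1_integrable; apply: measurable_bounded_integrable => //.
- by rewrite (le_lt_trans (probability_le1 _ _))// ltry.
- by apply: measurableT_comp => //; exact: continuous_measurable_rV.
- exists M; split; first exact: num_real.
  by move=> N MN x _ /=; rewrite (le_trans (gM _))// ltW.
Qed.

Lemma integral_distribution_affine d (T : measurableType d) (P : probability T R)
    (X : {RV P >-> 'rV[R]_k}) (g : 'rV[R]_k -> R) (M a c : R) :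
  continuous g -> (forall x, `|g x| <= M) -> (forall x, 0 <= c + g x * a) ->
  (\int[distribution P X]_x (c + g x * a)%:E =
   (c + fine 'E_P[g \o X] * a)%:E)%E.
Proof.
move=> cg gM h0; have gL := bounded_Lfun1 X cg gM.
have mg := continuous_measurable_rV cg.
rewrite (ge0_integral_distribution X); last 2 first.
- by apply/measurable_EFinP; apply: measurable_funD => //; exact: measurable_funM.
- by move=> x; rewrite lee_fin.
have -> : (\int[P]_x ((fun x => (c + g x * a)%:E) \o X) x =
    'E_P[cst c \+ (a \o* (g \o X))])%E by rewrite unlock.
rewrite expectationD ?expectation_cst ?expectationZl//; last 2 first.
- exact: Lfun_cst.
- apply/Lfun1_integrable; have /Lfun1_integrable/(integrableZl measurableT a) := gL.
  by apply: eq_integrable => // x _; rewrite /= muleC EFinM.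
by rewrite EFinD EFinM fineK ?expectation_fin_num// muleC.
Qed.

End expectation.

(** * Tent functions between two concentric boxes *)

Section tent.
Variables (R : realType) (k : nat).

Lemma ler_dist_max0 (a b : R) : `|Num.max 0 a - Num.max 0 b| <= `|a - b|.
Proof.
have h1 := ler_norm (a - b); have h2 := ler_norm (b - a); rewrite distrC in h2.
by rewrite ler_norml; case: (leP 0 a) => a0; case: (leP 0 b) => b0; lra.
Qed.

(** The function 1 minus the weighted total excess of x over the smaller box, cut off
at 0: one coordinate outside the larger box already has weighted excess above 1. *)
Lemma tent_exists (c w : 'rV[R]_k) (s : R) : s < 1 -> (forall i, 0 < w ord0 i) ->
  exists g : 'rV[R]_k -> R, [/\ unif_continuous g, (forall x, 0 <= g x <= 1),
    (forall x : 'rV[R]_k, (forall i, `|x ord0 i - c ord0 i| <= s * w ord0 i) -> g x = 1) &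
    (forall (x : 'rV[R]_k) i, w ord0 i < `|x ord0 i - c ord0 i| -> g x = 0)].
Proof.
move=> s1 w0.
pose l i := ((1 - s) * w ord0 i)^-1.
have l0 i : 0 < l i by rewrite invr_gt0 mulr_gt0// subr_gt0.
pose ex (x : 'rV[R]_k) i := Num.max 0 (`|x ord0 i - c ord0 i| - s * w ord0 i).
have ex0 x i : 0 <= ex x i by rewrite le_max lexx.
pose g x := Num.max 0 (1 - \sum_i l i * ex x i).
exists g; split.
- apply/unif_continuousP => e e0.
  pose L := 1 + \sum_i l i.
  have L0 : 0 < L by rewrite ltr_pwDl// sumr_ge0// => i _; exact: ltW.
  exists (e / L); first by rewrite /= divr_gt0.
  move=> [x y] [_ /= xy]; rewrite /ball/=.
  apply: (le_lt_trans (ler_dist_max0 _ _)).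
  rewrite (_ : _ - _ - _ = \sum_i l i * (ex y i - ex x i)); last first.
    by under [RHS]eq_bigr do rewrite mulrBr; rewrite sumrB; ring.
  apply: (le_lt_trans (ler_norm_sum _ _ _)).
  apply: (@le_lt_trans _ _ (\sum_i l i * (e / L))).
    apply: ler_sum => i _; rewrite normrM (gtr0_norm (l0 i)) ler_wpM2l ?(ltW (l0 i))//.
    apply: (le_trans (ler_dist_max0 _ _)).
    have -> : `|y ord0 i - c ord0 i| - s * w ord0 i -
      (`|x ord0 i - c ord0 i| - s * w ord0 i) =
      `|y ord0 i - c ord0 i| - `|x ord0 i - c ord0 i| by ring.
    apply: (le_trans (ler_dist_dist _ _)).
    rewrite (_ : _ - _ - _ = y ord0 i - x ord0 i); last by ring.
    by have := xy ord0 i; rewrite /ball/= distrC => /ltW.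
  rewrite -mulr_suml mulrCA gtr_pMr// ltr_pdivrMr// mul1r.
  by rewrite /L ltrDr.
- move=> x; rewrite le_max lexx/= ge_max ler01/= gerBl sumr_ge0// => i _.
  by rewrite mulr_ge0// ltW.
- move=> x xc; rewrite /g big1 ?subr0 ?(max_idPr ler01)// => i _.
  by rewrite /ex (max_idPl _) ?mulr0// subr_le0.
- move=> x i wx; apply/max_idPl; rewrite subr_le0 (bigD1 i)//=.
  rewrite (@le_trans _ _ (l i * ex x i))//; last first.
    by rewrite lerDl sumr_ge0// => j _; rewrite mulr_ge0// ltW.
  rewrite mulrC ler_pdivlMr ?mulr_gt0 ?subr_gt0// mul1r.
  by rewrite le_max mulrBl mul1r lerD2r (ltW wx) orbT.
Qed.

(** Shrinking a box about its centre by the factor s multiplies its volume by s ^ k,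
which can be kept above t. *)
Lemma box_bump_exists (a b : 'rV[R]_k) (t : R) : (forall i, a ord0 i < b ord0 i) ->
  0 <= t < 1 ->
  exists (g : 'rV[R]_k -> R) (a' b' : 'rV[R]_k), [/\ unif_continuous g,
    forall x, \1_(coord_box a' b') x <= g x <= \1_(coord_box a b) x,
    coord_box a' b' `<=` coord_box a b,
    coord_box a' b' !=set0 &
    (t%:E * lebesgue_rV k (coord_box a b) <= lebesgue_rV k (coord_box a' b'))%E].
Proof.
move=> ab t01.
have [s /andP[s0 s1] ts] := exists_lt1_expr_ge k t01.
pose c : 'rV[R]_k := \row_i ((a ord0 i + b ord0 i) / 2).
pose w : 'rV[R]_k := \row_i ((b ord0 i - a ord0 i) / 2).
have w0 i : 0 < w ord0 i by rewrite mxE divr_gt0// subr_gt0.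
have abP x : coord_box a b x <-> forall i, `|x ord0 i - c ord0 i| <= w ord0 i.
  split=> h i; move: (h i); rewrite ler_distl !mxE => /andP[h1 h2];
    apply/andP; split; lra.
pose a' : 'rV[R]_k := \row_i (c ord0 i - s * w ord0 i).
pose b' : 'rV[R]_k := \row_i (c ord0 i + s * w ord0 i).
have a'E i : a' ord0 i = c ord0 i - s * w ord0 i by rewrite [LHS]mxE.
have b'E i : b' ord0 i = c ord0 i + s * w ord0 i by rewrite [LHS]mxE.
have abP' x : coord_box a' b' x <->
    forall i, `|x ord0 i - c ord0 i| <= s * w ord0 i.
  by split=> h i; move: (h i); rewrite ler_distl a'E b'E.
have a'b' i : a' ord0 i <= b' ord0 i.
  rewrite a'E b'E lerD2l.
  by rewrite (@le_trans _ _ 0) ?oppr_le0 ?mulr_ge0// ltW.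
have sub' : coord_box a' b' `<=` coord_box a b.
  move=> x /abP' h; apply/abP => i; apply: (le_trans (h i)).
  by rewrite ger_pMl ?(ltW s1).
have [g [gu g01 g1 g0]] := tent_exists c s1 w0.
exists g, a', b'; split => //.
- move=> x; have /andP[gx0 gx1] := g01 x; apply/andP; split.
    rewrite indicE; case: (asboolP (coord_box a' b' x)) => [/[dup] xB|xB].
      by rewrite mem_set// => /abP' /g1 ->.
    by rewrite memNset.
  rewrite indicE; case: (asboolP (coord_box a b x)) => [xB|xB].
    by rewrite mem_set.
  rewrite memNset//= leNgt; apply/negP => gx; apply: xB; apply/abP => i.
  by rewrite leNgt; apply/negP => /g0 gx'; rewrite gx' ltxx in gx.
- by exists a' => i; rewrite lexx a'b'.
- rewrite !lebesgue_rV_coord_box//; last by move=> i; exact: ltW.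
  have -> : \prod_i (b' ord0 i - a' ord0 i) = s ^+ k * \prod_i (b ord0 i - a ord0 i).
    have -> : s ^+ k = \prod_(i < k) s by rewrite prodr_const card_ord.
    rewrite -big_split/=; apply: eq_bigr => i _.
    by rewrite a'E b'E !mxE; field.
  rewrite -EFinM lee_fin ler_wpM2r// prodr_ge0// => i _.
  by rewrite subr_ge0 ltW.
Qed.

End tent.

(** * The two implications *)

Section proposition.
Variables (R : realType) (k : nat).

Lemma vol_inf_le_distribution d (T : measurableType d) (P : probability T R)
    (X : {RV P >-> 'rV[R]_k}) (f : 'rV[R]_k -> R) (a b : 'rV[R]_k) (B : set 'rV[R]_k) :
  has_density X f -> coord_box a b `<=` B -> coord_box a b !=set0 ->
  (lebesgue_rV k (coord_box a b) * ereal_inf [set (f x)%:E | x in B] <=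
   distribution P X (coord_box a b))%E.
Proof.
move=> [mf f0 fX] abB [x0 abx0].
have mab : measurable (coord_box a b) by exact: measurable_coord_box.
rewrite fX//.
set l := ereal_inf _.
have l0 : (0 <= l)%E by apply: le_ereal_inf_tmp => _ [x _ <-]; rewrite lee_fin.
have lle x : coord_box a b x -> (l <= (f x)%:E)%E.
  by move=> abx; apply: ereal_inf_lbound; exists x => //; exact: abB.
rewrite muleC -(integral_cst (lebesgue_rV k) mab).
apply: ge0_le_integral => //.
by apply: measurable_funTS; exact/measurable_EFinP.
Qed.

(** A function g between the indicators of a slightly smaller box and of B gives
E g(Xn) <= mu_n(B) on one side, and bounds E g(X) below by the mass of the smaller
box on the other.  When B is degenerate there is no room for g, but the volume
is 0. *)
Lemma cvg_in_distribution_box d (T : measurableType d) (P : probability T R)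
    (X : {RV P >-> 'rV[R]_k}) (f : 'rV[R]_k -> R)
    (dn : nat -> measure_display) (Tn : forall n, measurableType (dn n))
    (Pn : forall n, probability (Tn n) R)
    (Xn : forall n, {RV (Pn n) >-> 'rV[R]_k}) (B : set 'rV[R]_k) (t : R) :
  has_density X f -> cvg_in_distribution Xn X -> closed_coord_box B -> t < 1 ->
  (t%:E * lebesgue_rV k B * ereal_inf [set (f x)%:E | x in B] <=
   limn_einf (fun n => distribution (Pn n) (Xn n) B))%E.
Proof.
move=> fX XnX [a [b [ab ->]]] t1.
set l := ereal_inf _.
have l0 : (0 <= l)%E.
  by case: fX => _ f0 _; apply: le_ereal_inf_tmp => _ [x _ <-]; rewrite lee_fin.
have liminf0 : (0 <= limn_einf
    (fun n => distribution (Pn n) (Xn n) (coord_box a b)))%E.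
  by apply: le_limn_einf_near; apply: nearW => n; exact: measure_ge0.
have [t0|t0] := ltP t 0.
  apply: le_trans liminf0; apply: mule_le0_ge0 => //.
  by apply: mule_le0_ge0; rewrite ?lee_fin ?(ltW t0)//; exact: measure_ge0.
have [/forallP abs|] := boolP [forall i, a ord0 i < b ord0 i]; last first.
  rewrite negb_forall => /existsP[i]; rewrite -leNgt => ba.
  have -> : lebesgue_rV k (coord_box a b) = 0%E.
    rewrite lebesgue_rV_coord_box// (bigD1 i)//=.
    suff -> : b ord0 i = a ord0 i by rewrite subrr mul0r.
    by apply/le_anti; rewrite ba ab.
  by rewrite mule0 mul0e.
have t01 : 0 <= t < 1 by rewrite t0.
have [g [a' [b' [gu g1 sub' ne' vol']]]] := box_bump_exists abs t01.
have cg := unif_continuous_continuous gu.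
have mg := continuous_measurable_rV cg.
have g0 x : 0 <= g x.
  by have /andP[/(le_trans _)->//] := g1 x; rewrite indicE.
have gM x : `|g x| <= 1.
  rewrite ger0_norm//; have /andP[_ gx] := g1 x; apply: (le_trans gx).
  by rewrite indicE; case: (_ \in _).
have Eg d' (T' : measurableType d') (P' : probability T' R) (X' : {RV P' >-> 'rV[R]_k}) :
    ('E_P'[g \o X'] = \int[distribution P' X']_x (g x)%:E)%E.
  by rewrite ge0_integral_distribution ?unlock//; exact/measurable_EFinP.
have mI (c e : 'rV[R]_k) (nu : probability 'rV[R]_k R) :
    nu (coord_box c e) = (\int[nu]_x (\1_(coord_box c e) x)%:E)%E.
  by rewrite integral_indic// ?setIT//; exact: measurable_coord_box.
apply: (@le_trans _ _ ('E_P[g \o X])%E).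
  apply: (@le_trans _ _ (lebesgue_rV k (coord_box a' b') * l)%E).
    by rewrite lee_wpmul2r.
  apply: (le_trans (vol_inf_le_distribution fX sub' ne')).
  rewrite Eg mI; apply: ge0_le_integral => //.
  - by apply/measurable_EFinP; apply: measurable_indic; exact: measurable_coord_box.
  - exact/measurable_EFinP.
  - by move=> x _; rewrite lee_fin; case/andP: (g1 x).
have /cvg_limn_einf_sup[<- _] := XnX g (ex_intro _ 1 gM) gu.
apply: le_limn_einf => n; rewrite Eg [leRHS]mI; apply: ge0_le_integral => //.
- by move=> x _; rewrite lee_fin.
- exact/measurable_EFinP.
- by apply/measurable_EFinP; apply: measurable_indic; exact: measurable_coord_box.
- by move=> x _; rewrite lee_fin; case/andP: (g1 x).
Qed.

(** The bounds of [near_integral_ge] are applied to M + 1 + g and M + 1 - g, which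
are at least 1; the sign is the parameter [sgn]. *)
Lemma box_cvg_in_distribution d (T : measurableType d) (P : probability T R)
    (X : {RV P >-> 'rV[R]_k}) (U : set 'rV[R]_k) (f : 'rV[R]_k -> R)
    (dn : nat -> measure_display) (Tn : forall n, measurableType (dn n))
    (Pn : forall n, probability (Tn n) R)
    (Xn : forall n, {RV (Pn n) >-> 'rV[R]_k}) :
  open U -> has_density X f ->
  (forall x, U x -> {for x, continuous f}) -> (forall x, U x -> 0 < f x) ->
  (forall x, ~ U x -> f x = 0) ->
  (forall t : R, 0 < t < 1 -> exists r : R, forall B,
    closed_coord_box B -> B `<=` U -> (r%:E * diam B < dist_set B (~` U))%E ->
    (t%:E * lebesgue_rV k B * ereal_inf [set (f x)%:E | x in B] <=
     limn_einf (fun n => distribution (Pn n) (Xn n) B))%E) ->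
  cvg_in_distribution Xn X.
Proof.
move=> Uo [mf f0 fX] cf fgt0 fU0 hbox g [M gM] gu.
have cg := unif_continuous_continuous gu.
have M0 : 0 <= M by rewrite (le_trans _ (gM 0)).
have muU : distribution P X (~` U) = 0%E.
  rewrite fX; last by apply: measurableC; exact: open_measurable_rV.
  by apply: integral0_eq => x /fU0 ->.
pose e := fine 'E_P[g \o X]%E; pose en n := fine 'E_(Pn n)[g \o Xn n]%E.
have gsgn (sgn : R) x : `|sgn| = 1 -> 0 <= M + g x * sgn.
  move=> sgn1; rewrite -lerBlDl sub0r lerNl.
  by rewrite (le_trans (ler_norm _))// normrN normrM sgn1 mulr1.
have side (sgn t : R) : `|sgn| = 1 -> 0 < t < 1 -> \forall n \near \oo,
    t ^+ 8 * (M + 1 + e * sgn) <= M + 1 + en n * sgn.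
  move=> sgn1 t01; have [r hr] := hbox t t01.
  have h1 x : 1 <= M + 1 + g x * sgn.
    by rewrite addrAC lerDr gsgn.
  have h0 x : 0 <= M + 1 + g x * sgn by exact: le_trans (h1 x).
  have ch x : {for x, continuous (fun x => M + 1 + g x * sgn)}.
    apply: continuousD; first exact: cst_continuous.
    by apply: continuousM; [exact: cg|exact: cst_continuous].
  have Ih := integral_distribution_affine _ cg gM h0.
  have := near_integral_ge (mun := fun n => distribution (Pn n) (Xn n))
    Uo muU mf f0 cf fgt0 fX ch h1 _ t01 hr.
  rewrite Ih ltry => /(_ isT); apply: filterS => n.
  by rewrite Ih -EFinM lee_fin.
have EE d' (T' : measurableType d') (P' : probability T' R) (X' : {RV P' >-> 'rV[R]_k}) :
    ('E_P'[g \o X'] = (fine 'E_P'[g \o X'])%:E)%E.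
  by rewrite fineK// expectation_fin_num//; exact: bounded_Lfun1 cg gM.
rewrite EE; under eq_fun do rewrite EE.
apply: cvg_EFin; first exact: nearW.
have eM : `|e| <= M.
  have sgnM (sgn : R) : `|sgn| = 1 -> 0 <= M + e * sgn.
    move=> sgn1; rewrite -lee_fin.
    have h0 x := gsgn sgn x sgn1.
    rewrite -(integral_distribution_affine X cg gM h0).
    by apply: integral_ge0 => x _; rewrite lee_fin.
  have := sgnM 1 (normr1 _); have := sgnM (-1) (normrN1 _).
  by rewrite mulr1 mulrN1 ler_norml => ? ?; apply/andP; split; lra.
apply: (@cvg_of_multiplicative_bounds _ 8 (M + 1) e en).
- by rewrite ltr_wpDl.
- by rewrite (le_trans eM)// lerDl.
- move=> t t01; have := side 1 t (normr1 _) t01.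
  by under eq_near do rewrite !mulr1.
- move=> t t01; have := side (-1) t (normrN1 _) t01.
  by under eq_near do rewrite !mulrN1.
Qed.

End proposition.

Theorem proposition1 (R : realType) (k : nat) (k_ge1 : (1 <= k)%N)
    (d : measure_display) (T : measurableType d) (P : probability T R)
    (X : {RV P >-> 'rV[R]_k})
    (U : set 'rV[R]_k) (U_open : open U)
    (fU : 'rV[R]_k -> R) (fU_continuous : {within U, continuous fU})
    (fU_gt0 : forall x, U x -> 0 < fU x)
    (X_density : has_density X (fun x => fU x * \1_U x))
    (dn : nat -> measure_display) (Tn : forall n, measurableType (dn n))
    (Pn : forall n, probability (Tn n) R)
    (Xn : forall n, {RV (Pn n) >-> 'rV[R]_k}) :
  cvg_in_distribution Xn X <->
  forall eps : R, 0 < eps ->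
    exists r : R, forall B : set 'rV[R]_k,
      closed_coord_box B -> B `<=` U ->
      (r%:E * diam B < dist_set B (~` U))%E ->
      ((1 - eps)%:E * lebesgue_rV k B
         * ereal_inf [set (fU x * \1_U x)%:E | x in B]
       <= limn_einf (fun n => distribution (Pn n) (Xn n) B))%E.
Proof.
split=> [XnX eps eps0|hbox].
  exists 0 => B Bbox _ _; apply: (cvg_in_distribution_box X_density XnX Bbox).
  by rewrite gtrDl oppr_lt0.
apply: (box_cvg_in_distribution (U := U)) X_density _ _ _ _ => //.
- move=> x Ux.
  have cfU : {for x, continuous fU}.
    by move: fU_continuous; rewrite continuous_open_subspace// => /(_ x); apply; rewrite inE.
  have fE : \forall y \near x, fU y = fU y * \1_U y.
    have : nbhs x U by exact: open_nbhs_nbhs.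
    by apply: filterS => y Uy; rewrite indicE mem_set// mulr1.
  have fx : fU x * \1_U x = fU x by rewrite indicE mem_set// mulr1.
  suff : (fun y => fU y * \1_U y) @ nbhs x --> fU x * \1_U x by [].
  rewrite fx.
  exact: cvg_trans (near_eq_cvg fE) cfU.
- by move=> x Ux; rewrite indicE mem_set// mulr1 fU_gt0.
- by move=> x Ux; rewrite indicE memNset// mulr0.
- move=> t /andP[t0 t1]; have /hbox[r hr] : 0 < 1 - t by rewrite subr_gt0.
  by exists r => B Bbox BU Bsep; have := hr B Bbox BU Bsep; rewrite subKr.
Qed.
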